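(* Let $m,n,p,q,r,s,t$ be arbitrary integers. Let $$A(x_1,x_2,x_3,x_4)=\begin{bmatrix}tx_1 & x_2 & tx_3 & x_4\\ mx_1+nx_2 & -tx_1 & mx_3+nx_4 & -tx_3\\ -qtx_3 & -qx_4 & tx_1+ptx_3 & x_2+px_4\\ -q(mx_3+nx_4) & qtx_3 & mx_1+nx_2+p(mx_3+nx_4) & -tx_1-ptx_3\end{bmatrix}$$ and $$P(x_1,\dots,x_8)=\begin{bmatrix}A(x_1,\dots,x_4) & A(x_5,\dots,x_8)\\ -sA(x_5,\dots,x_8) & A(x_1,\dots,x_4)+rA(x_5,\dots,x_8)\end{bmatrix}.$$ Then there exist trilinear forms $w_1,\dots,w_8$ in independent variables $x_i,y_i,z_i$ ($i=1,\dots,8$), with coefficients integer polynomials in the parameters, such that $P(x)P(y)P(z)=P(w)$. Consequently the octonary octic form $f=\det P$ satisfies $f(x_1,\dots,x_8)f(y_1,\dots,y_8)f(z_1,\dots,z_8)=f(w_1,\dots,w_8)$ identically. *)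

(* Defs.v *)
From HB Require Import structures.
From mathcomp Require Import all_boot all_order all_algebra.
From mathcomp Require Import mpoly.
Set Implicit Arguments. Unset Strict Implicit. Unset Printing Implicit Defensive.
Import Order.TTheory GRing.Theory Num.Theory.
Local Open Scope ring_scope.

Definition prm_of (m n p q r s t : int) : 'I_7 -> int :=
  fun i => nth 0 [:: m; n; p; q; r; s; t] i.

Definition Amat (m n p q t : int) (x : 'I_4 -> int) : 'M[int]_4 :=
  let x1 := x 0%R in let x2 := x 1%R in let x3 := x 2%R in let x4 := x 3%R in
  let rows : seq (seq int) :=
    [:: [:: t * x1; x2; t * x3; x4];
        [:: m * x1 + n * x2; - (t * x1); m * x3 + n * x4; - (t * x3)];
        [:: - (q * t * x3); - (q * x4); t * x1 + p * t * x3; x2 + p * x4];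
        [:: - (q * (m * x3 + n * x4)); q * t * x3;
            m * x1 + n * x2 + p * (m * x3 + n * x4); - (t * x1) - p * t * x3]] in
  \matrix_(i < 4, j < 4) nth 0 (nth [::] rows i) j.

(* The 8x8 matrix P(x1,...,x8); x : 'I_8 -> int, x (i) = x_(i+1). *)
Definition Pmat (m n p q r s t : int) (x : 'I_8 -> int) : 'M[int]_(4 + 4) :=
  let A1 := Amat m n p q t (fun i : 'I_4 => x (lshift 4 i)) in
  let A2 := Amat m n p q t (fun i : 'I_4 => x (rshift 4 i)) in
  block_mx A1 A2 (- (s *: A2)) (A1 + r *: A2).

Definition fform (m n p q r s t : int) (x : 'I_8 -> int) : int :=
  \det (Pmat m n p q r s t x).

Definition trilin (c : 'I_8 -> 'I_8 -> 'I_8 -> 'I_8 -> {mpoly int[7]})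
  (prm : 'I_7 -> int) (x y z : 'I_8 -> int) : 'I_8 -> int :=
  fun l => \sum_(i < 8) \sum_(j < 8) \sum_(k < 8)
             (c i j k l).@[prm] * x i * y j * z k.

(* Main.v *)
Require Import Defs.
From HB Require Import structures.
From mathcomp Require Import all_boot all_order all_algebra.
From mathcomp Require Import mpoly ring.
Import GRing.Theory.
Local Open Scope ring_scope.

(* Let K = R[w]/(w^2 - p w + q), with elements stored as pairs (a, b) = a + b w.
   Up to a reordering of coordinates, A(x1,x2,x3,x4) is the real form of the
   2x2 matrix M(al, be) = [[t al, be], [m al + n be, - t al]] over K, where
   al = x1 + x3 w and be = x2 + x4 w.  A direct computation shows that a
   product of three such matrices is again of this shape, M(ga, de), with
   ga, de explicit cubic expressions (gammaK, deltaK): this is [Amat_triple].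
   Next, P(x) = A(x') (x) 1 + A(x'') (x) T, where x', x'' are the two halves of
   x and T = [[0, 1], [-s, r]] satisfies T^2 = r T - s; expanding the product
   of three such matrices in R[T] gives the halves of w ([Pmat_triple]).
   The resulting map (x, y, z) |-> w is trilinear, and is defined over any
   commutative ring in a way that commutes with ring morphisms.  Evaluating it
   at generic parameters in {mpoly int[7]} on basis vectors produces the
   coefficient polynomials; trilinear expansion then shows that the frozen
   [trilin] of these coefficients is exactly w.  The statement on f = det P
   follows from multiplicativity of the determinant. *)

(* Arithmetic of the quadratic algebra R[w]/(w^2 - p w + q). *)
Section QuadraticAlgebra.
Variables (R : comNzRingType) (p q : R).

Definition qmul (u v : R * R) : R * R :=
  (u.1 * v.1 - q * (u.2 * v.2), u.1 * v.2 + u.2 * v.1 + p * (u.2 * v.2)).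
Definition qadd (u v : R * R) : R * R := (u.1 + v.1, u.2 + v.2).
Definition qscale (k : R) (u : R * R) : R * R := (k * u.1, k * u.2).
Definition qmul3 (u v w : R * R) : R * R := qmul (qmul u v) w.

End QuadraticAlgebra.
Arguments qmul {R}. Arguments qadd {R}. Arguments qscale {R}. Arguments qmul3 {R}.

(* The coordinates of the triple product M(a) M(b) M(c) of the matrices
   behind A, over an arbitrary commutative ring. *)
Section ATriple.
Variables (R : comNzRingType) (m n p q t : R).

Definition alpha (x : 'I_4 -> R) : R * R := (x 0%R, x 2%R).
Definition beta (x : 'I_4 -> R) : R * R := (x 1%R, x 3%R).

Local Notation "u ** v ** w" := (qmul3 p q u v w) (at level 40, v at next level).
Local Notation "u +q v" := (qadd u v) (at level 50, left associativity).
Local Notation "k *q u" := (qscale k u) (at level 40).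

Definition gammaK (a1 b1 a2 b2 a3 b3 : R * R) : R * R :=
  (t * t) *q (a1 ** a2 ** a3) +q n *q (b1 ** b2 ** a3) +q m *q (a1 ** b2 ** a3)
  +q (- n) *q (b1 ** a2 ** b3) +q n *q (a1 ** b2 ** b3).

Definition deltaK (a1 b1 a2 b2 a3 b3 : R * R) : R * R :=
  (t * t) *q (a1 ** a2 ** b3) +q (- (t * t)) *q (a1 ** b2 ** a3)
  +q m *q (b1 ** a2 ** b3) +q (t * t) *q (b1 ** a2 ** a3) +q n *q (b1 ** b2 ** b3).

Definition Atriple (a b c : 'I_4 -> R) (i : 'I_4) : R :=
  let g := gammaK (alpha a) (beta a) (alpha b) (beta b) (alpha c) (beta c) in
  let d := deltaK (alpha a) (beta a) (alpha b) (beta b) (alpha c) (beta c) in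
  match nat_of_ord i with 0 => g.1 | 1 => d.1 | 2 => g.2 | _ => d.2 end.

End ATriple.
Arguments alpha {R}. Arguments beta {R}. Arguments gammaK {R}. Arguments deltaK {R}.
Arguments Atriple {R}.

Ltac unfold_Atriple := cbv [gammaK deltaK qmul3 qmul qadd qscale alpha beta fst snd].

(* The four coordinates of Atriple, at the indices used by Amat; stating them
   avoids a costly simplification of the whole product matrix. *)
Lemma AtripleE {R : comNzRingType} (m n p q t : R) (a b c : 'I_4 -> R) :
  let g := gammaK m n p q t (alpha a) (beta a) (alpha b) (beta b) (alpha c) (beta c) in
  let d := deltaK m n p q t (alpha a) (beta a) (alpha b) (beta b) (alpha c) (beta c) in
  [/\ Atriple m n p q t a b c 0%R = g.1, Atriple m n p q t a b c 1%R = d.1,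
      Atriple m n p q t a b c 2%R = g.2 & Atriple m n p q t a b c 3%R = d.2].
Proof. by []. Qed.

Lemma Amat_triple (m n p q t : int) (a b c : 'I_4 -> int) :
  Amat m n p q t a *m Amat m n p q t b *m Amat m n p q t c
  = Amat m n p q t (Atriple m n p q t a b c).
Proof.
apply/matrixP => i j; rewrite !mxE !big_ord_recr !big_ord0 /= !mxE.
rewrite !big_ord_recr !big_ord0 /= !mxE.
have [-> -> -> ->] := AtripleE m n p q t a b c.
by case: i => [[|[|[|[|i]]]] Hi] //=; case: j => [[|[|[|[|j]]]] Hj] //=;
  unfold_Atriple; ring.
Qed.

Lemma eq_Amat (m n p q t : int) (x x' : 'I_4 -> int) :
  x =1 x' -> Amat m n p q t x = Amat m n p q t x'.
Proof. by move=> ex; rewrite /Amat !ex. Qed.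
Arguments eq_Amat {m n p q t x x'}.

(* The triple product in P: writing x = (lo x, hi x) for x1 + x2 T with
   T^2 = r T - s, hence T^3 = (r^2 - s) T - r s, the halves of the product of
   x, y and z (with A-triples in place of products of scalars) are: *)
Section PTriple.
Variables (R : comNzRingType) (m n p q r s t : R).

Definition lo (x : 'I_8 -> R) (i : 'I_4) : R := x (lshift 4 i).
Definition hi (x : 'I_8 -> R) (i : 'I_4) : R := x (rshift 4 i).

Local Notation A := (Atriple m n p q t).

Definition PtripleLo (x y z : 'I_8 -> R) (i : 'I_4) : R :=
  A (lo x) (lo y) (lo z) i - s * A (hi x) (hi y) (lo z) i - s * A (lo x) (hi y) (hi z) i
  - s * A (hi x) (lo y) (hi z) i - r * s * A (hi x) (hi y) (hi z) i.

Definition PtripleHi (x y z : 'I_8 -> R) (i : 'I_4) : R :=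
  A (lo x) (lo y) (hi z) i + A (lo x) (hi y) (lo z) i + A (hi x) (lo y) (lo z) i
  + r * (A (hi x) (hi y) (lo z) i + A (lo x) (hi y) (hi z) i + A (hi x) (lo y) (hi z) i)
  + (r * r - s) * A (hi x) (hi y) (hi z) i.

Definition Ptriple (x y z : 'I_8 -> R) (l : 'I_8) : R :=
  match @split 4 4 l with inl i => PtripleLo x y z i | inr i => PtripleHi x y z i end.

Lemma lo_Ptriple x y z : lo (Ptriple x y z) =1 PtripleLo x y z.
Proof. by move=> i; rewrite /lo /Ptriple (unsplitK (inl i)). Qed.

Lemma hi_Ptriple x y z : hi (Ptriple x y z) =1 PtripleHi x y z.
Proof. by move=> i; rewrite /hi /Ptriple (unsplitK (inr i)). Qed.

End PTriple.
Arguments lo {R}. Arguments hi {R}. Arguments lo_Ptriple {R}. Arguments hi_Ptriple {R}.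
Arguments Ptriple {R}. Arguments PtripleLo {R}. Arguments PtripleHi {R}.

Lemma eq_Pmat (m n p q r s t : int) (x x' : 'I_8 -> int) :
  x =1 x' -> Pmat m n p q r s t x = Pmat m n p q r s t x'.
Proof.
move=> ex; rewrite /Pmat.
by rewrite (@eq_Amat _ _ _ _ _ (lo x) (lo x') (fun i => ex _))
  (@eq_Amat _ _ _ _ _ (hi x) (hi x') (fun i => ex _)).
Qed.

Lemma Pmat_triple (m n p q r s t : int) (x y z : 'I_8 -> int) :
  Pmat m n p q r s t x *m Pmat m n p q r s t y *m Pmat m n p q r s t z
  = Pmat m n p q r s t (Ptriple m n p q r s t x y z).
Proof.
rewrite [RHS]/Pmat (eq_Amat (lo_Ptriple _ _ _ _ _ _ _ _ _ _))
  (eq_Amat (hi_Ptriple _ _ _ _ _ _ _ _ _ _)).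
rewrite /Pmat !mulmx_block.
congr block_mx;
  do 3 rewrite ?(mulmxDl, mulmxDr, mulmxN, mulNmx) -?scalemxAl -?scalemxAr;
  rewrite ?mulmxA !Amat_triple;
  apply/matrixP => i j; rewrite !mxE;
  case: i => [[|[|[|[|i]]]] Hi] //=; case: j => [[|[|[|[|j]]]] Hj] //=;
  rewrite /PtripleLo /PtripleHi; ring.
Qed.

(* Linear forms on functions I -> R, stated pointwise so that no function
   extensionality is needed. *)
Definition linear_form {R : comNzRingType} {I : Type} (F : (I -> R) -> R) : Prop :=
  forall u v x x' w, (forall a, w a = u * x a + v * x' a) -> F w = u * F x + v * F x'.

Definition delta {R : comNzRingType} {I : eqType} (i : I) (a : I) : R := (a == i)%:R.

Lemma linear_form_ext {R : comNzRingType} {I : Type} {F : (I -> R) -> R} {x x'} :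
  linear_form F -> x =1 x' -> F x = F x'.
Proof.
move=> linF ex; rewrite (linF 1 0 x' x' x) ?mul1r ?mul0r ?addr0 // => a.
by rewrite ex mul1r mul0r addr0.
Qed.

Lemma linear_form_expand {R : comNzRingType} {I : finType} {F : (I -> R) -> R} x :
  linear_form F -> F x = \sum_i x i * F (delta i).
Proof.
move=> linF.
have expand_seq (sq : seq I) w : (forall a, w a = \sum_(i <- sq) x i * delta i a) ->
    F w = \sum_(i <- sq) x i * F (delta i).
  elim: sq w => [|i sq IH] w ew.
    rewrite big_nil (linF 0 0 w w w) ?mul0r ?addr0 // => a.
    by rewrite ew big_nil mul0r addr0.
  rewrite big_cons (linF (x i) 1 (delta i) (fun b => \sum_(j <- sq) x j * delta j b) w).
    by rewrite mul1r (IH _ (fun a => erefl)).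
  by move=> a; rewrite ew big_cons mul1r.
apply: expand_seq => a; rewrite (bigD1 a) //= big1 ?addr0 /delta ?eqxx ?mulr1 //.
by move=> i /negbTE; rewrite eq_sym => ->; rewrite mulr0.
Qed.

Definition trilinear {R : comNzRingType} {I J : Type}
    (G : (I -> R) -> (I -> R) -> (I -> R) -> J -> R) : Prop :=
  [/\ forall y z l, linear_form (fun x => G x y z l),
      forall x z l, linear_form (fun y => G x y z l)
    & forall x y l, linear_form (fun z => G x y z l)].

Lemma trilinear_ext {R : comNzRingType} {I J : Type}
    {G : (I -> R) -> (I -> R) -> (I -> R) -> J -> R} {x x' y y' z z'} :
  trilinear G -> x =1 x' -> y =1 y' -> z =1 z' -> G x y z =1 G x' y' z'.
Proof.
move=> [lin1 lin2 lin3] ex ey ez l.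
have /= -> := linear_form_ext (lin1 y z l) ex.
have /= -> := linear_form_ext (lin2 x' z l) ey.
by have /= -> := linear_form_ext (lin3 x' y' l) ez.
Qed.

Lemma trilinear_expand {R : comNzRingType} {I : finType} {J : Type}
    {G : (I -> R) -> (I -> R) -> (I -> R) -> J -> R} x y z l :
  trilinear G -> G x y z l = \sum_i \sum_j \sum_k
    G (delta i) (delta j) (delta k) l * x i * y j * z k.
Proof.
move=> [lin1 lin2 lin3].
have /= -> := linear_form_expand x (lin1 y z l); apply: eq_bigr => i _.
have /= -> := linear_form_expand y (lin2 (delta i) z l).
rewrite big_distrr; apply: eq_bigr => j _ /=.
have /= -> := linear_form_expand z (lin3 (delta i) (delta j) l).
by rewrite !big_distrr; apply: eq_bigr => k _ /=; ring.
Qed.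

Section ATripleLinear.
Variables (R : comNzRingType) (m n p q t u v : R).

Lemma Atriple_linear1 (a a' w : 'I_4 -> R) : (forall i, w i = u * a i + v * a' i) ->
  forall b c i, Atriple m n p q t w b c i
    = u * Atriple m n p q t a b c i + v * Atriple m n p q t a' b c i.
Proof.
move=> ew b c i; rewrite /Atriple; case: (nat_of_ord i) => [|[|[|?]]];
  unfold_Atriple; rewrite !ew; ring.
Qed.

Lemma Atriple_linear2 (b b' w : 'I_4 -> R) : (forall i, w i = u * b i + v * b' i) ->
  forall a c i, Atriple m n p q t a w c i
    = u * Atriple m n p q t a b c i + v * Atriple m n p q t a b' c i.
Proof.
move=> ew a c i; rewrite /Atriple; case: (nat_of_ord i) => [|[|[|?]]];
  unfold_Atriple; rewrite !ew; ring.
Qed.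

Lemma Atriple_linear3 (c c' w : 'I_4 -> R) : (forall i, w i = u * c i + v * c' i) ->
  forall a b i, Atriple m n p q t a b w i
    = u * Atriple m n p q t a b c i + v * Atriple m n p q t a b c' i.
Proof.
move=> ew a b i; rewrite /Atriple; case: (nat_of_ord i) => [|[|[|?]]];
  unfold_Atriple; rewrite !ew; ring.
Qed.

End ATripleLinear.
Arguments Atriple_linear1 {R m n p q t u v a a' w}.
Arguments Atriple_linear2 {R m n p q t u v b b' w}.
Arguments Atriple_linear3 {R m n p q t u v c c' w}.

Section PTripleLinear.
Variables (R : comNzRingType) (m n p q r s t : R).

Lemma Ptriple_linear1 y z l : linear_form (fun x => Ptriple m n p q r s t x y z l).
Proof.
move=> u v x x' w ew /=.
have Elo := Atriple_linear1 (fun i => ew (lshift 4 i) : lo w i = _).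
have Ehi := Atriple_linear1 (fun i => ew (rshift 4 i) : hi w i = _).
by rewrite /Ptriple; case: split => i; rewrite /PtripleLo /PtripleHi !Elo !Ehi; ring.
Qed.

Lemma Ptriple_linear2 x z l : linear_form (fun y => Ptriple m n p q r s t x y z l).
Proof.
move=> u v y y' w ew /=.
have Elo := Atriple_linear2 (fun i => ew (lshift 4 i) : lo w i = _).
have Ehi := Atriple_linear2 (fun i => ew (rshift 4 i) : hi w i = _).
by rewrite /Ptriple; case: split => i; rewrite /PtripleLo /PtripleHi !Elo !Ehi; ring.
Qed.

Lemma Ptriple_linear3 x y l : linear_form (fun z => Ptriple m n p q r s t x y z l).
Proof.
move=> u v z z' w ew /=.
have Elo := Atriple_linear3 (fun i => ew (lshift 4 i) : lo w i = _).
have Ehi := Atriple_linear3 (fun i => ew (rshift 4 i) : hi w i = _).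
by rewrite /Ptriple; case: split => i; rewrite /PtripleLo /PtripleHi !Elo !Ehi; ring.
Qed.

Lemma Ptriple_trilinear : trilinear (Ptriple m n p q r s t).
Proof.
by split=> *; [exact: Ptriple_linear1 | exact: Ptriple_linear2 | exact: Ptriple_linear3].
Qed.

End PTripleLinear.
Arguments Ptriple_trilinear {R}.

Section TripleMorphism.
Variables (R S : comNzRingType) (f : {rmorphism R -> S}) (m n p q r s t : R).

Lemma Atriple_rmorph a b c i :
  f (Atriple m n p q t a b c i)
  = Atriple (f m) (f n) (f p) (f q) (f t) (f \o a) (f \o b) (f \o c) i.
Proof.
rewrite /Atriple; case: (nat_of_ord i) => [|[|[|?]]]; unfold_Atriple;
  by rewrite !(rmorphD, rmorphB, rmorphN, rmorphM).
Qed.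

Lemma Ptriple_rmorph x y z l :
  f (Ptriple m n p q r s t x y z l)
  = Ptriple (f m) (f n) (f p) (f q) (f r) (f s) (f t) (f \o x) (f \o y) (f \o z) l.
Proof.
rewrite /Ptriple; case: split => i;
  by rewrite /PtripleLo /PtripleHi !(rmorphD, rmorphB, rmorphN, rmorphM) !Atriple_rmorph.
Qed.

End TripleMorphism.

(* The coefficients c_ijkl: Ptriple on basis vectors, computed at the generic
   parameters 'X_0, ..., 'X_6 (standing for m, n, p, q, r, s, t). *)
Definition coef_poly (i j k l : 'I_8) : {mpoly int[7]} :=
  Ptriple 'X_0 'X_1 'X_2 'X_3 'X_4 'X_5 'X_6 (delta i) (delta j) (delta k) l.

Lemma coef_poly_eval (m n p q r s t : int) i j k l :
  (coef_poly i j k l).@[prm_of m n p q r s t]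
  = Ptriple m n p q r s t (delta i) (delta j) (delta k) l.
Proof.
rewrite Ptriple_rmorph /= !mevalXU.
have eval_delta (a b : 'I_8) :
    (delta a b : {mpoly int[7]}).@[prm_of m n p q r s t] = delta a b.
  by rewrite /delta rmorph_nat.
exact: (trilinear_ext (Ptriple_trilinear m n p q r s t)
  (eval_delta i) (eval_delta j) (eval_delta k)).
Qed.

Lemma trilin_coef_poly (m n p q r s t : int) x y z :
  trilin coef_poly (prm_of m n p q r s t) x y z =1 Ptriple m n p q r s t x y z.
Proof.
move=> l; rewrite /trilin (trilinear_expand x y z l (Ptriple_trilinear m n p q r s t)).
apply: eq_bigr => i _; apply: eq_bigr => j _; apply: eq_bigr => k _.
by rewrite coef_poly_eval.
Qed.

Theorem mainTheorem14 :
  exists c : 'I_8 -> 'I_8 -> 'I_8 -> 'I_8 -> {mpoly int[7]},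
    forall (m n p q r s t : int) (x y z : 'I_8 -> int),
      let w := trilin c (prm_of m n p q r s t) x y z in
      Pmat m n p q r s t x *m Pmat m n p q r s t y *m Pmat m n p q r s t z
        = Pmat m n p q r s t w /\
      fform m n p q r s t x * fform m n p q r s t y * fform m n p q r s t z
        = fform m n p q r s t w.
Proof.
exists coef_poly => m n p q r s t x y z w.
have Pw : Pmat m n p q r s t w = Pmat m n p q r s t (Ptriple m n p q r s t x y z).
  exact/eq_Pmat/trilin_coef_poly.
have PxPyPz := Pmat_triple m n p q r s t x y z.
split; first by rewrite Pw.
by rewrite /fform -!det_mulmx PxPyPz Pw.
Qed.
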